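(* Let $Q$ be a quiver with $3$ vertices. If $Q$ is not mutation-acyclic, then no quiver in $\mathrm{mut}(Q)$ has a maximal green sequence. In all cases, there are at most $6$ quivers, up to isomorphism (relabelling of vertices), in $\mathrm{mut}(Q)$ that admit a maximal green sequence.
   Context: A quiver is a finite directed multigraph with no loops and no oriented 2-cycles. Mutation $\mu_k$: for every path $i\to k\to j$ add an arrow $i\to j$, reverse all arrows at $k$, delete a maximal collection of oriented 2-cycles. $\mathrm{mut}(Q)$ is the set of quivers obtained from $Q$ by sequences of mutations. A quiver is acyclic if it has no oriented cycles; $Q$ is mutation-acyclic if $\mathrm{mut}(Q)$ contains an acyclic quiver. Maximal green sequences: the framed quiver $\hat Q$ adds, for each vertex $i$, a frozen vertex $i'$ and an arrow $i\to i'$ (frozen vertices are never mutated; arrows between frozen vertices are discarded). A non-frozen vertex $i$ of a quiver obtained from $\hat Q$ by mutations is green if there is no arrow $j'\to i$ from a frozen vertex, red if there is no arrow $i\to j'$. A sequence $(i_1,\dots,i_l)$ is a maximal green sequence for $Q$ if each $i_t$ is green in $\mu_{i_{t-1}}\cdots\mu_{i_1}(\hat Q)$ and all non-frozen vertices of $\mu_{i_l}\cdots\mu_{i_1}(\hat Q)$ are red. *)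

(* Defs.v *)
From HB Require Import structures.
From mathcomp Require Import all_boot.

Set Implicit Arguments.
Unset Strict Implicit.
Unset Printing Implicit Defensive.

(* A multigraph on T is given by the number a (i, j) of arrows i -> j. *)
Definition is_quiver (T : finType) (a : {ffun T * T -> nat}) : bool :=
  [forall i, a (i, i) == 0]
  && [forall i, forall j, (a (i, j) == 0) || (a (j, i) == 0)].

Record quiver (T : finType) := Quiver {
  arrows : {ffun T * T -> nat};
  arrowsP : is_quiver arrows
}.

HB.instance Definition _ (T : finType) := [isSub for @arrows T].
HB.instance Definition _ (T : finType) := [Equality of quiver T by <:].

Definition arr (T : finType) (Q : quiver T) (i j : T) : nat := arrows Q (i, j).

(* Deleting a maximal collection of 2-cycles: min (a i j) (a j i) of them lie
   on {i, j}, which leaves the truncated difference a i j - a j i. *)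
Definition cancel_2cycles (T : finType) (a : T -> T -> nat) :
  {ffun T * T -> nat} := [ffun p => a p.1 p.2 - a p.2 p.1].

Lemma cancel_2cyclesP (T : finType) (a : T -> T -> nat) :
  is_quiver (cancel_2cycles a).
Proof.
apply/andP; split; apply/forallP => i; first by rewrite ffunE /= subnn.
apply/forallP => j; rewrite !ffunE /= !subn_eq0; exact: leq_total.
Qed.

Definition add_paths (T : finType) (k : T) (a : T -> T -> nat) : T -> T -> nat :=
  fun i j => a i j + a i k * a k j.

Definition reverse_at (T : finType) (k : T) (a : T -> T -> nat) : T -> T -> nat :=
  fun i j => if (i == k) || (j == k) then a j i else a i j.

Definition mutate (T : finType) (Q : quiver T) (k : T) : quiver T :=
  Quiver (cancel_2cyclesP (reverse_at k (add_paths k (arr Q)))).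

Definition in_mut (T : finType) (Q R : quiver T) : Prop :=
  exists s : seq T, R = foldl (@mutate T) Q s.

(* [cycle e [:: x_1; ...; x_m]] says e x_1 x_2, ..., e x_m x_1; only the empty
   sequence is a cycle by convention. *)
Definition acyclic (T : finType) (Q : quiver T) : Prop :=
  forall c : seq T, cycle (fun i j => 0 < arr Q i j) c -> c = [::].

Definition mutation_acyclic (T : finType) (Q : quiver T) : Prop :=
  exists2 R : quiver T, in_mut Q R & acyclic R.

Definition isomorphic (T U : finType) (Q : quiver T) (R : quiver U) : Prop :=
  exists2 f : T -> U, bijective f & forall i j, arr R (f i) (f j) = arr Q i j.

(* In quivers on T + T, inl i is the mutable vertex i and inr i its frozen
   copy i'. *)
Definition framed_arrows (T : finType) (Q : quiver T) :
  {ffun (T + T) * (T + T) -> nat} :=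
  [ffun p => match p with
             | (inl i, inl j) => arr Q i j
             | (inl i, inr j) => (i == j : nat)
             | (inr _, _) => 0
             end].

Lemma framed_arrowsP (T : finType) (Q : quiver T) :
  is_quiver (framed_arrows Q).
Proof.
have /andP[/forallP loops /forallP cycles] := arrowsP Q.
apply/andP; split; apply/forallP => -[i|i]; rewrite ?ffunE //; first exact: loops.
- apply/forallP => -[j|j]; rewrite !ffunE /= ?orbT //.
  by have /forallP := cycles i; apply.
- by apply/forallP => j; rewrite !ffunE.
Qed.

Definition framed (T : finType) (Q : quiver T) : quiver (T + T)%type :=
  Quiver (framed_arrowsP Q).

Definition discard_frozen_arrows (T : finType) (Q : quiver (T + T)%type) :
  {ffun (T + T) * (T + T) -> nat} :=
  [ffun p => match p with
             | (inr _, inr _) => 0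
             | (x, y) => arr Q x y
             end].

Lemma discard_frozen_arrowsP (T : finType) (Q : quiver (T + T)%type) :
  is_quiver (discard_frozen_arrows Q).
Proof.
have /andP[/forallP loops /forallP cycles] := arrowsP Q.
apply/andP; split; apply/forallP => -[i|i]; rewrite ?ffunE //; first exact: loops.
- by apply/forallP => -[j|j]; rewrite !ffunE; have /forallP := cycles (inl i); apply.
- apply/forallP => -[j|j]; rewrite !ffunE //.
  by have /forallP := cycles (inr i); apply.
Qed.

Definition ice_mutate (T : finType) (Q : quiver (T + T)%type) (k : T) :
  quiver (T + T)%type :=
  Quiver (discard_frozen_arrowsP (mutate Q (inl k))).

Definition green (T : finType) (Q : quiver (T + T)%type) (i : T) : Prop :=
  forall j : T, arr Q (inr j) (inl i) = 0.

Definition red (T : finType) (Q : quiver (T + T)%type) (i : T) : Prop :=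
  forall j : T, arr Q (inl i) (inr j) = 0.

Fixpoint green_to_red (T : finType) (Q : quiver (T + T)%type) (s : seq T) : Prop :=
  match s with
  | [::] => forall i : T, red Q i
  | k :: s' => green Q k /\ green_to_red (ice_mutate Q k) s'
  end.

Definition maximal_green_sequence (T : finType) (Q : quiver T) (s : seq T) : Prop :=
  green_to_red (framed Q) s.

Definition has_mgs (T : finType) (Q : quiver T) : Prop :=
  exists s : seq T, maximal_green_sequence Q s.

(* Main.v *)
(* Let b be the skew-symmetric exchange matrix and c_i the c-vector of i, whose
   coordinates count the arrows from i to the frozen vertices; a mutation at a
   green vertex k replaces c_k by - c_k and c_i by c_i + max(b_ik, 0) c_k.
   If every vertex k receives at least two arrows from some vertex l (a "heavy"
   quiver), then after a first mutation at k we have b_kl >= 2 and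
   c_k <= 0 <= c_k + c_l.  This condition, enlarged by five exceptional ones
   which occur when some multiplicity is at most 1, is stable under green
   mutations, and in each of the six cases linear independence of the c-vectors
   provides a vertex which is not red; hence a heavy quiver has no maximal green
   sequence.  A quiver on 3 vertices which is not heavy is acyclic or is a cycle
   with an arrow of multiplicity 1, which becomes acyclic after at most two
   mutations; this gives the first assertion.  For the second one, start from an acyclic
   quiver with multiplicities a, b, c.  The three acyclic quivers obtained by
   source and sink mutations and the three cycles adjacent to them (a slightly
   different list if one of a, b, c is 0) are closed under mutation up to heavy
   cycles created by increasing the largest multiplicity, and from such a cycle
   every mutation except the one leading back creates another one. *)
Require Import Defs.
From mathcomp Require Import all_boot all_order all_algebra.
From mathcomp Require Import zify.
From Stdlib Require Import Classical.

Set Implicit Arguments.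
Unset Strict Implicit.
Unset Printing Implicit Defensive.

Import Order.TTheory GRing.Theory Num.Theory.
Local Open Scope ring_scope.

(** * Signed multiplicities and matrix mutation *)

Definition pos (x : int) : int := Num.max x 0.

Definition skew (U : finType) (R : quiver U) (i j : U) : int :=
  (arr R i j)%:Z - (arr R j i)%:Z.

Lemma posE (x : int) : (0 <= x /\ pos x = x) \/ (x <= 0 /\ pos x = 0).
Proof. rewrite /pos; lia. Qed.

Lemma pos_id (x : int) : 0 <= x -> pos x = x.
Proof. rewrite /pos; lia. Qed.

Lemma pos_0 (x : int) : x <= 0 -> pos x = 0.
Proof. rewrite /pos; lia. Qed.

Lemma arr_two_cycle (U : finType) (R : quiver U) (i j : U) :
  arr R i j = 0%N \/ arr R j i = 0%N.
Proof.
have /andP[_ /forallP /(_ i) /forallP /(_ j) /orP[] /eqP h] := arrowsP R;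
  by [left | right].
Qed.

Lemma arr_skew (U : finType) (R : quiver U) (i j : U) :
  (arr R i j)%:Z = pos (skew R i j).
Proof. by rewrite /pos /skew; case: (arr_two_cycle R i j) => ->; lia. Qed.

Lemma skewC (U : finType) (R : quiver U) (i j : U) : skew R i j = - skew R j i.
Proof. rewrite /skew; lia. Qed.

Lemma quiver_ext (U : finType) (R R' : quiver U) :
  (forall i j, skew R i j = skew R' i j) -> R = R'.
Proof.
move=> h; apply: val_inj; apply/ffunP => -[i j].
have := arr_skew R i j; rewrite h -arr_skew; rewrite /arr /=; lia.
Qed.

(** The Fomin-Zelevinsky matrix rule. Cancelling 2-cycles leaves no trace in it, since only the
    difference of the two arrow counts enters. *)
Lemma skew_mutate (U : finType) (R : quiver U) (k i j : U) :
  skew (mutate R k) i j =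
    if (i == k) || (j == k) then - skew R i j
    else skew R i j + pos (skew R i k) * pos (skew R k j)
         - pos (skew R j k) * pos (skew R k i).
Proof.
rewrite -!arr_skew /skew /arr /= /arr /= !ffunE /= /reverse_at /add_paths /arr.
(* [add_paths] is applied at all pairs, also those containing [k]; there its product has a factor
   counting loops at [k]. *)
have loop : arrows R (k, k) = 0%N.
  by have /andP[/forallP /(_ k) /eqP ->] := arrowsP R.
rewrite [(j == k) || _]orbC; case: ifP => [/orP[] /eqP -> | _].
- by rewrite !loop; lia.
- by rewrite !loop; lia.
- by lia.
Qed.
Lemma mutateK (U : finType) (k : U) : involutive (fun R : quiver U => mutate R k).
Proof.
move=> R; apply: quiver_ext => i j; rewrite !skew_mutate eqxx ?orbT /=.
rewrite (skewC R j k) (skewC R k i) !opprK.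
case: (_ || _); lia.
Qed.

Lemma skew_ice (T : finType) (R : quiver (T + T)%type) (k i : T) (x : T + T) :
  skew (ice_mutate R k) (inl i) x = skew (mutate R (inl k)) (inl i) x.
Proof. by case: x => x; rewrite /skew {1 2}/arr 2!ffunE. Qed.

(** * Exchange matrix and c-vectors under green mutations *)

Definition mskew (T : finType) (R : quiver (T + T)%type) (i j : T) : int :=
  skew R (inl i) (inl j).

Lemma mskewC (T : finType) (R : quiver (T + T)%type) (i j : T) :
  mskew R i j = - mskew R j i.
Proof. exact: skewC. Qed.

Definition cvec (T : finType) (R : quiver (T + T)%type) (i t : T) : int :=
  skew R (inl i) (inr t).

Lemma green_cvec (T : finType) (R : quiver (T + T)%type) (k t : T) :
  green R k -> 0 <= cvec R k t.
Proof. by move=> /(_ t) gk; rewrite /cvec /skew gk; lia. Qed.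

Lemma red_cvec (T : finType) (R : quiver (T + T)%type) (k t : T) :
  red R k -> cvec R k t <= 0.
Proof. by move=> /(_ t) rk; rewrite /cvec /skew rk; lia. Qed.

(** Greenness of [k] means that its c-vector is nonnegative, so no arrow enters [k] from a frozen
    vertex and one of the two products in the mutation rule vanishes. *)
Lemma cvec_ice_green (T : finType) (R : quiver (T + T)%type) (k i t : T) :
  green R k ->
  cvec (ice_mutate R k) i t =
    if i == k then - cvec R k t
    else cvec R i t + pos (mskew R i k) * cvec R k t.
Proof.
move=> gk; have ck := green_cvec t gk.
rewrite /cvec /mskew skew_ice skew_mutate (inj_eq inl_inj) orbF.
case: eqP => [-> // | _].
rewrite [skew R (inr t) _]skewC -/(cvec R k t) /pos.
have -> : Num.max (cvec R k t) 0 = cvec R k t by lia.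
have -> : Num.max (- cvec R k t) 0 = 0 by lia.
by lia.
Qed.

Lemma mskew_framed (T : finType) (R : quiver T) (i j : T) :
  mskew (framed R) i j = skew R i j.
Proof. by rewrite /mskew /skew /arr !ffunE. Qed.

Lemma cvec_framed (T : finType) (R : quiver T) (i t : T) :
  cvec (framed R) i t = (i == t).
Proof. by rewrite /cvec /skew /arr !ffunE subr0. Qed.

(** Everything is expressed through the three cyclic entries [p q], [q r], [r p], with the mutated
    vertex in the middle, so that arithmetic tactics can treat them as three integer unknowns. *)
Lemma ice_mutate_green (T : finType) (R : quiver (T + T)%type) (p q r : T) :
  uniq [:: p; q; r] -> green R q ->
  [/\ mskew (ice_mutate R q) p q = - mskew R p q,
      mskew (ice_mutate R q) q r = - mskew R q r &
      mskew (ice_mutate R q) r p = mskew R r p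
        + pos (- mskew R q r) * pos (- mskew R p q)
        - pos (mskew R p q) * pos (mskew R q r)] /\
  forall t, [/\ 0 <= cvec R q t,
      cvec (ice_mutate R q) p t = cvec R p t + pos (mskew R p q) * cvec R q t,
      cvec (ice_mutate R q) q t = - cvec R q t &
      cvec (ice_mutate R q) r t = cvec R r t + pos (- mskew R q r) * cvec R q t].
Proof.
move=> /and3P[]; rewrite !inE negb_or => /andP[pq pr] qr _ gq; split.
  rewrite /mskew !skew_ice !skew_mutate !(inj_eq inl_inj) !eqxx !orbT.
  rewrite (negPf pq) [r == q]eq_sym (negPf qr) /=.
  by rewrite (skewC R (inl r) (inl q)) (skewC R (inl q) (inl p)).
move=> t; split; first exact: green_cvec.
- by rewrite cvec_ice_green // (negPf pq).
- by rewrite cvec_ice_green // eqxx.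
- by rewrite cvec_ice_green // [r == q]eq_sym (negPf qr) mskewC.
Qed.

(** * Independence of the c-vectors and trapped configurations *)

Definition independent (T : finType) (R : quiver (T + T)%type) (p q r : T) :=
  forall x y z : int,
    (forall t, x * cvec R p t + y * cvec R q t + z * cvec R r t = 0) ->
    [/\ x = 0, y = 0 & z = 0].

Lemma independent_rot (T : finType) (R : quiver (T + T)%type) (p q r : T) :
  independent R p q r -> independent R q r p.
Proof.
move=> ind x y z h.
by have [|-> -> ->] := ind z x y; first by move=> t; rewrite -(h t); lia.
Qed.

Lemma independent_swap (T : finType) (R : quiver (T + T)%type) (p q r : T) :
  independent R p q r -> independent R q p r.
Proof.
move=> ind x y z h.
by have [|-> -> ->] := ind y x z; first by move=> t; rewrite -(h t); lia.
Qed.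

(** A green mutation acts on the c-vectors by an invertible integer matrix. *)
Lemma independent_step (T : finType) (R : quiver (T + T)%type) (p q r : T) :
  uniq [:: p; q; r] -> green R q -> independent R p q r ->
  independent (ice_mutate R q) p q r.
Proof.
move=> u gq ind x y z h; have [_ c] := ice_mutate_green u gq.
have [|x0 y0 z0] :=
    (* The middle coefficient collects all occurrences of the old c-vector of [q] in the new
       combination. *)
    ind x (pos (mskew R p q) * x + pos (- mskew R q r) * z - y) z.
  move=> t; have := h t; have [_ -> -> ->] := c t; rewrite !mulrDl mulNr; lia.
by move: y0; rewrite x0 z0 !mulr0; split=> //; lia.
Qed.

(* The labels S, U, V, P, F, A of the six alternatives reappear in the names of
   the lemmas trap_mutate_*.  S is the main one; U and V arise from S by mutating
   the third vertex r when there are arrows p -> r and at most one arrow q -> r,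
   P when there is one arrow q -> r and none p -> r.  P may lead to F, and F and A
   lead to each other when all multiplicities are 1. *)
Definition trapped (T : finType) (R : quiver (T + T)%type) (p q r : T) : Prop :=
  let x := mskew R p q in let y := mskew R q r in let z := mskew R r p in
  let u := cvec R p in let v := cvec R q in let w := cvec R r in
  (* S *)
  [/\ 2 <= x & forall t, u t <= 0 <= u t + v t] \/
  (* U *)
  [/\ 2 <= x, 2 <= y, z <= y &
      forall t, [/\ u t <= 0, 0 <= w t & 0 <= u t + v t + w t]] \/
  (* V *)
  [/\ x = 1, 2 <= y, z + 2 <= y &
      forall t, [/\ u t <= 0, u t + v t <= 0, 0 <= w t & 0 <= u t + v t + w t]] \/
  (* P *)
  [/\ x = 1, y + 2 <= z &
      forall t, [/\ u t <= 0, w t <= 0, 0 <= u t + v t & 0 <= u t + v t + w t]] \/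
  (* F *)
  [/\ x = 1, 1 <= y, z = -1 &
      forall t, [/\ u t <= 0, 0 <= w t, u t + w t <= 0, u t + v t <= 0
                  & 0 <= u t + v t + w t]] \/
  (* A *)
  [/\ x = 1, y = 1, z = -1 &
      forall t, [/\ u t <= 0, v t <= 0, 2 * u t + v t + w t <= 0
                  & 0 <= u t + v t + w t]].

Lemma independent_neq0 (T : finType) (R : quiver (T + T)%type) (p q r : T) :
  independent R p q r -> ~ forall t, cvec R p t = 0.
Proof.
by move=> ind h; have [|] := ind 1 0 0 => // t; rewrite h; lia.
Qed.

(** In S and P the c-vector of [q] is nonnegative, in the other alternatives that of [r].
    Independence makes it nonzero, whereas a red vertex has a nonpositive c-vector. *)
Lemma trapped_not_red (T : finType) (R : quiver (T + T)%type) (p q r : T) :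
  independent R p q r -> trapped R p q r -> exists i, ~ red R i.
Proof.
move=> ind; have indr := independent_rot ind.
have n1 := independent_neq0 ind.
have n2 := independent_neq0 indr.
have n3 := independent_neq0 (independent_rot indr).
have nr i : (~ forall t, cvec R i t = 0) -> (forall t, 0 <= cvec R i t) ->
    exists i, ~ red R i.
  move=> n0 h; exists i => ri; apply: n0 => t.
  have := h t; have := red_cvec t ri; lia.
case=> [[_ h]|[[_ _ _ h]|[[_ _ _ h]|[[_ _ h]|[[_ _ _ h]|[_ _ _ h]]]]]].
- by apply: (nr q) => // t; have := h t; lia.
- by apply: (nr r) => // t; case: (h t).
- by apply: (nr r) => // t; case: (h t).
- by apply: (nr q) => // t; case: (h t); lia.
- by apply: (nr r) => // t; case: (h t).
- by apply: (nr r) => // t; case: (h t); lia.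
Qed.

Definition basis (T : finType) (R : quiver (T + T)%type) (p q r : T) : Prop :=
  uniq [:: p; q; r] /\ independent R p q r.

Lemma basis_rot (T : finType) (R : quiver (T + T)%type) (p q r : T) :
  basis R p q r -> basis R q r p.
Proof.
case=> u /independent_rot i; split=> //.
by rewrite -[[:: q; r; p]]/(rot 1 [:: p; q; r]) rot_uniq.
Qed.

Lemma basis_swap (T : finType) (R : quiver (T + T)%type) (p q r : T) :
  basis R p q r -> basis R q p r.
Proof.
case=> u /independent_swap i; split=> //.
by move: u; rewrite /= !inE !negb_or [q == p]eq_sym => /and3P[/andP[-> ->] -> _].
Qed.

(** * Stability of the trapped configurations *)

Definition trap (T : finType) (R : quiver (T + T)%type) : Prop :=
  exists p q r, basis R p q r /\ trapped R p q r.

Ltac bases := eauto 6 using basis_rot, basis_swap.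

Lemma nonpositive_not_green (T : finType) (R : quiver (T + T)%type) (p q r : T) :
  basis R p q r -> (forall t, cvec R p t <= 0) -> ~ green R p.
Proof.
move=> [_ ind] h gp; apply: (independent_neq0 ind) => t.
have := green_cvec t gp; have := h t; lia.
Qed.

(** The basis [b] must have the mutated vertex in the middle. The unnamed facts feed the new basis
    to [bases] and skew-symmetry to [lia]. *)
Ltac mutation b gk R k p q r e1 e2 e3 c :=
  have [[e1 e2 e3] c] := ice_mutate_green (proj1 b) gk;
  have ? := conj (proj1 b) (independent_step (proj1 b) gk (proj2 b));
  have ? := mskewC (ice_mutate R k) p q;
  have ? := mskewC (ice_mutate R k) q r;
  have ? := mskewC (ice_mutate R k) r p.

(** Vertex [p] cannot be green. Mutation at [q] exchanges the roles of [p] and [q]: the new sum is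
    [u + (x - 1) v], which is at least [u + v] because [x] is at least 2. Only [r] can lead out of
    S. *)
Lemma trap_mutate_S (T : finType) (R : quiver (T + T)%type) (p q r k : T) :
  basis R p q r -> k \in [:: p; q; r] -> green R k ->
  2 <= mskew R p q -> (forall t, cvec R p t <= 0 <= cvec R p t + cvec R q t) ->
  trap (ice_mutate R k).
Proof.
move=> b; rewrite !inE => /or3P[] /eqP -> gk hx h.
- by case: (independent_neq0 (proj2 b)) => t; have := green_cvec t gk; have := h t; lia.
- have [[e1 e2 e3] c] := ice_mutate_green (proj1 b) gk.
  have b' := conj (proj1 b) (independent_step (proj1 b) gk (proj2 b)).
  have s1 := mskewC (ice_mutate R q) p q.
  exists q, p, r; split; first exact: basis_swap.
  left; split; first by lia.
  move=> t; have := h t; have [? -> ->] := c t.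
  by case: (posE (mskew R p q)) => -[? ->] _; nia.
- have b1 := basis_rot b.
  have [[e1 e2 e3] c] := ice_mutate_green (proj1 b1) gk.
  have b' := conj (proj1 b1) (independent_step (proj1 b1) gk (proj2 b1)).
  have s1 := mskewC (ice_mutate R r) q r.
  have s2 := mskewC (ice_mutate R r) r p.
  have s3 := mskewC (ice_mutate R r) p q.
  (* With two arrows from [q] to [r], the pair [r], [q] satisfies S after the mutation. *)
  have [y2|y1] := leP 2 (mskew R q r).
    exists r, q, p; split; first by bases.
    left; split; first by lia.
    move=> t; have := h t; have [? -> -> _] := c t.
    rewrite pos_id; [nia | lia].
  have [z0|z0] := leP 0 (mskew R r p).
    rewrite [pos (- mskew R r p)]pos_0 ?mul0r in e3 c; last by lia.
    have [y0|y0] := leP (mskew R q r) 0.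
      rewrite pos_0 // in e3 c.
      exists p, q, r; split; first by bases.
      left; split; first by lia.
      move=> t; have := h t; have [? -> _ ->] := c t; lia.
    exists r, q, p; split; first by bases.
    have y11 : mskew R q r = 1 by lia.
    rewrite y11 !pos_id // in e3 c.
    right; right; right; left; split; [by lia | by lia |].
    by move=> t; have := h t; have [? -> -> ->] := c t; split; lia.
  (* There are arrows from [p] to [r]. The four bounds below replace a case split on the sign of
     [mskew R q r]. *)
  rewrite [pos (- mskew R r p)]pos_id ?[pos (mskew R r p)]pos_0 in e3 c; try lia.
  have p1 : 0 <= pos (- mskew R q r) by rewrite /pos; lia.
  have p2 : - mskew R q r <= pos (- mskew R q r) by rewrite /pos; lia.
  have p3 : pos (mskew R q r) <= 1 by rewrite /pos; lia.
  have p4 : 0 <= pos (mskew R q r) by rewrite /pos; lia.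
  exists r, p, q; split; first by bases.
  right; have [g2|g1] := leP 2 (- mskew R r p); [left|right; left].
    split; [by lia | by nia | by nia |].
    by move=> t; have := h t; have [? -> -> ->] := c t; split; nia.
  have g : mskew R r p = -1 by lia.
  rewrite g in e2 e3 c.
  split; [by lia | by nia | by nia |].
  by move=> t; have := h t; have [? -> -> ->] := c t; split; nia.
Qed.

(** Mutation at [q] stays in U with [p] and [q] exchanged: the entry [p r] becomes [x y - z], at
    least [y] since [z <= y] and [2 <= x]. Mutation at [r] gives S for [r], [q]. *)
Lemma trap_mutate_U (T : finType) (R : quiver (T + T)%type) (p q r k : T) :
  basis R p q r -> k \in [:: p; q; r] -> green R k ->
  2 <= mskew R p q -> 2 <= mskew R q r -> mskew R r p <= mskew R q r ->
  (forall t, [/\ cvec R p t <= 0, 0 <= cvec R r t &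
                 0 <= cvec R p t + cvec R q t + cvec R r t]) ->
  trap (ice_mutate R k).
Proof.
move=> b; rewrite !inE => /or3P[] /eqP -> gk hx hy hz h.
- by case: (nonpositive_not_green b _ gk) => t; case: (h t).
- mutation b gk R q p q r e1 e2 e3 c.
  rewrite ![pos (- _)]pos_0 ?pos_id in e3 c; try lia.
  exists q, p, r; split; first by bases.
  right; left; split; [lia | nia | nia |].
  by move=> t; case: (h t) => *; have [? -> -> ->] := c t; split; nia.
- have b1 := basis_rot b.
  mutation b1 gk R r p q r e1 e2 e3 c.
  exists r, q, p; split; first by bases.
  left; split; first by lia.
  move=> t; case: (h t) => *; have [? -> -> _] := c t.
  rewrite pos_id; [nia | lia].
Qed.

(** Mutation at [q] makes the entry [p r] equal to [y - z], at least 2, and gives S for [p], [r];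
    mutation at [r] gives S for [r], [q]. *)
Lemma trap_mutate_V (T : finType) (R : quiver (T + T)%type) (p q r k : T) :
  basis R p q r -> k \in [:: p; q; r] -> green R k ->
  mskew R p q = 1 -> 2 <= mskew R q r -> mskew R r p + 2 <= mskew R q r ->
  (forall t, [/\ cvec R p t <= 0, cvec R p t + cvec R q t <= 0,
                 0 <= cvec R r t & 0 <= cvec R p t + cvec R q t + cvec R r t]) ->
  trap (ice_mutate R k).
Proof.
move=> b; rewrite !inE => /or3P[] /eqP -> gk hx hy hz h.
- by case: (nonpositive_not_green b _ gk) => t; case: (h t).
- mutation b gk R q p q r e1 e2 e3 c.
  rewrite hx ![pos (- _)]pos_0 ?pos_id in e3 c; try lia.
  exists p, r, q; split; first by bases.
  left; split; first by lia.
  by move=> t; case: (h t) => *; have [? -> _ ->] := c t; lia.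
- have b1 := basis_rot b.
  mutation b1 gk R r p q r e1 e2 e3 c.
  exists r, q, p; split; first by bases.
  left; split; first by lia.
  move=> t; case: (h t) => *; have [? -> -> _] := c t.
  rewrite pos_id; [nia | lia].
Qed.

(** Only [q] can be green. The result is S for [r], [p] if [y >= 0], S for [q], [r] if [y <= -2],
    and F in the remaining case [y = -1]. *)
Lemma trap_mutate_P (T : finType) (R : quiver (T + T)%type) (p q r k : T) :
  basis R p q r -> k \in [:: p; q; r] -> green R k ->
  mskew R p q = 1 -> mskew R q r + 2 <= mskew R r p ->
  (forall t, [/\ cvec R p t <= 0, cvec R r t <= 0, 0 <= cvec R p t + cvec R q t
                & 0 <= cvec R p t + cvec R q t + cvec R r t]) ->
  trap (ice_mutate R k).
Proof.
move=> b; rewrite !inE => /or3P[] /eqP -> gk hx hy h.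
- by case: (nonpositive_not_green b _ gk) => t; case: (h t).
- mutation b gk R q p q r e1 e2 e3 c.
  rewrite hx [pos 1]pos_id // [pos (-1)]pos_0 // in e3 c.
  have [y0|y0] := leP 0 (mskew R q r).
    rewrite [pos (- _)]pos_0 ?pos_id in e3 c; try lia.
    exists r, p, q; split; first by bases.
    left; split; first by lia.
    by move=> t; case: (h t) => *; have [? -> _ ->] := c t; lia.
  rewrite [pos (- _)]pos_id ?pos_0 in e3 c; try lia.
  have [y2|y1] := leP (mskew R q r) (-2).
    exists q, r, p; split; first by bases.
    left; split; first by lia.
    by move=> t; case: (h t) => *; have [? _ -> ->] := c t; nia.
  have y11 : mskew R q r = -1 by lia.
  rewrite y11 in e3 c.
  exists q, r, p; split; first by bases.
  do 4!right; left; split; [lia | lia | lia |].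
  by move=> t; case: (h t) => *; have [? -> -> ->] := c t; split; lia.
- case: (nonpositive_not_green (basis_rot (basis_rot b)) _ gk) => t.
  by case: (h t).
Qed.

(** Mutation at [q] turns the entry [p r] into [y + 1] and gives S for [p], [r]. Mutation at [r]
    gives S for [r], [q] if [y >= 2], and A if [y = 1]. *)
Lemma trap_mutate_F (T : finType) (R : quiver (T + T)%type) (p q r k : T) :
  basis R p q r -> k \in [:: p; q; r] -> green R k ->
  mskew R p q = 1 -> 1 <= mskew R q r -> mskew R r p = -1 ->
  (forall t, [/\ cvec R p t <= 0, 0 <= cvec R r t, cvec R p t + cvec R r t <= 0,
                 cvec R p t + cvec R q t <= 0
               & 0 <= cvec R p t + cvec R q t + cvec R r t]) ->
  trap (ice_mutate R k).
Proof.
move=> b; rewrite !inE => /or3P[] /eqP -> gk hx hy hz h.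
- by case: (nonpositive_not_green b _ gk) => t; case: (h t).
- mutation b gk R q p q r e1 e2 e3 c.
  rewrite hx ![pos (- _)]pos_0 ?pos_id in e3 c; try lia.
  exists p, r, q; split; first by bases.
  left; split; first by lia.
  by move=> t; case: (h t) => *; have [? -> _ ->] := c t; lia.
- have b1 := basis_rot b.
  mutation b1 gk R r p q r e1 e2 e3 c.
  rewrite hz [pos (- mskew _ _ _)]pos_0 ?[pos (-1)]pos_0 ?pos_id in e3 c; try lia.
  have [y2|y1] := leP 2 (mskew R q r).
    exists r, q, p; split; first by bases.
    left; split; first by lia.
    by move=> t; case: (h t) => *; have [? -> -> _] := c t; nia.
  have y11 : mskew R q r = 1 by lia.
  rewrite y11 in e3 c.
  exists r, p, q; split; first by bases.
  do 5!right; split; [lia | lia | lia |].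
  by move=> t; case: (h t) => *; have [? -> -> ->] := c t; split; lia.
Qed.

(** Only [r] can be green, and mutating it leads to F for the order [r], [p], [q]. *)
Lemma trap_mutate_A (T : finType) (R : quiver (T + T)%type) (p q r k : T) :
  basis R p q r -> k \in [:: p; q; r] -> green R k ->
  mskew R p q = 1 -> mskew R q r = 1 -> mskew R r p = -1 ->
  (forall t, [/\ cvec R p t <= 0, cvec R q t <= 0,
                 2 * cvec R p t + cvec R q t + cvec R r t <= 0
               & 0 <= cvec R p t + cvec R q t + cvec R r t]) ->
  trap (ice_mutate R k).
Proof.
move=> b; rewrite !inE => /or3P[] /eqP -> gk hx hy hz h.
- by case: (nonpositive_not_green b _ gk) => t; case: (h t).
- by case: (nonpositive_not_green (basis_rot b) _ gk) => t; case: (h t).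
- have b1 := basis_rot b.
  mutation b1 gk R r p q r e1 e2 e3 c.
  rewrite hy hz opprK [pos (-1)]pos_0 // [pos 1]pos_id // in e3 c.
  exists r, p, q; split; first by bases.
  do 4!right; left; split; [lia | lia | lia |].
  by move=> t; case: (h t) => *; have [? -> -> ->] := c t; split; lia.
Qed.

Lemma mem_card3 (T : finType) (p q r k : T) :
  #|T| = 3%N -> uniq [:: p; q; r] -> k \in [:: p; q; r].
Proof.
move=> hT u; have /card_uniqP cu := u.
have /subset_cardP : #|[:: p; q; r]| = #|T| by rewrite hT cu.
by move=> /(_ (subset_predT _)) ->.
Qed.

Lemma trap_step (T : finType) (R : quiver (T + T)%type) (k : T) :
  #|T| = 3%N -> trap R -> green R k -> trap (ice_mutate R k).
Proof.
move=> hT [p [q [r [b tr]]]] gk.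
have kin : k \in [:: p; q; r] by apply: mem_card3 (proj1 b).
case: tr => [[? h]|[[? ? ? h]|[[? ? ? h]|[[? ? h]|[[? ? ? h]|[? ? ? h]]]]]].
- exact: trap_mutate_S b kin gk _ h.
- exact: trap_mutate_U b kin gk _ _ _ h.
- exact: trap_mutate_V b kin gk _ _ _ h.
- exact: trap_mutate_P b kin gk _ _ h.
- exact: trap_mutate_F b kin gk _ _ _ h.
- exact: trap_mutate_A b kin gk _ _ _ h.
Qed.

Lemma trap_not_green_to_red (T : finType) (R : quiver (T + T)%type) (s : seq T) :
  #|T| = 3%N -> trap R -> ~ green_to_red R s.
Proof.
move=> hT; elim: s R => [|k s IH] R tr /=; last first.
  by case=> gk; apply/IH/trap_step.
have [p [q [r [[_ ind] t]]]] := tr.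
by have [i ni] := trapped_not_red ind t => /(_ i).
Qed.

(** * Heavy quivers have no maximal green sequence *)

Definition heavy (T : finType) (R : quiver T) : bool :=
  [forall k, exists l, (2 <= arr R l k)%N].

Lemma triple_exists (T : finType) (p q : T) :
  #|T| = 3%N -> p != q -> exists r, uniq [:: p; q; r].
Proof.
move=> hT pq; have : (0 < #|predC (mem [:: p; q])|)%N.
  have /card_uniqP c2 : uniq [:: p; q] by rewrite /= inE pq.
  have : (2 + #|predC (mem [:: p; q])| = 3)%N.
    by rewrite -hT -(cardC (mem [:: p; q])) c2.
  by lia.
case/card_gt0P => r; rewrite !inE negb_or => /andP[rp rq].
by exists r; rewrite /= !inE negb_or pq eq_sym rp eq_sym rq.
Qed.

Lemma independent_framed (T : finType) (R : quiver T) (p q r : T) :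
  uniq [:: p; q; r] -> independent (framed R) p q r.
Proof.
move=> /and3P[]; rewrite !inE negb_or => /andP[pq pr] qr _ x y z h.
have := h p; have := h q; have := h r; rewrite !cvec_framed !eqxx.
rewrite (eq_sym q p) (eq_sym r p) (eq_sym r q) (negPf pq) (negPf pr) (negPf qr).
by split; lia.
Qed.

Lemma heavy_no_mgs (T : finType) (R : quiver T) :
  #|T| = 3%N -> heavy R -> ~ has_mgs R.
Proof.
move=> hT /forallP hv [[|k s]] /=.
  move=> /(_ _) red; have /card_gt0P[t _] : (0 < #|T|)%N by rewrite hT.
  have := red_cvec t (red t); by rewrite cvec_framed eqxx.
case=> gk; apply: trap_not_green_to_red => //.
have /existsP[l hl] := hv k.
have lk : l != k.
  by apply: contraTneq hl => ->; case: (arr_two_cycle R k k) => ->.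
have [r u] := triple_exists hT lk.
have [[e1 e2 e3] c] := ice_mutate_green u gk.
(* After the first mutation the c-vector of [k] is minus a unit vector, and that of [l] contains the
   unit vector of [k] at least twice: this is S for [k], [l]. *)
exists k, l, r; split.
  apply: basis_swap; split=> //.
  by apply: independent_step => //; apply: independent_framed.
left; split.
  rewrite mskewC e1 opprK mskew_framed; have := arr_skew R l k; rewrite /pos; lia.
have w2 : 2 <= mskew (framed R) l k.
  by rewrite mskew_framed; have := arr_skew R l k; rewrite /pos; lia.
move=> t; have [_ -> -> _] := c t; rewrite !cvec_framed pos_id; last by lia.
by case: (k == t); case: (l == t) => /=; lia.
Qed.

(** * Mutation classes and shapes of quivers on three vertices *)

Lemma in_mut_trans (T : finType) (Q R P : quiver T) :
  in_mut Q R -> in_mut R P -> in_mut Q P.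
Proof. by case=> s -> [s' ->]; exists (s ++ s'); rewrite foldl_cat. Qed.

Lemma in_mut_step (T : finType) (Q R : quiver T) (k : T) :
  in_mut Q R -> in_mut Q (mutate R k).
Proof. by case=> s ->; exists (rcons s k); rewrite foldl_rcons. Qed.

Lemma in_mut_refl (T : finType) (Q : quiver T) : in_mut Q Q.
Proof. by exists [::]. Qed.

Lemma in_mut_sym (T : finType) (Q R : quiver T) : in_mut Q R -> in_mut R Q.
Proof.
case=> s ->; elim/last_ind: s => [|s k IH]; first exact: in_mut_refl.
rewrite foldl_rcons; apply: in_mut_trans IH.
by exists [:: k]; rewrite /= [RHS]mutateK.
Qed.

(* S lists the signed multiplicities along x -> k -> z -> x; a vertex order only
   matters up to cyclic rotation and, with a change of signs, reversal. *)
Definition shaped_at (T : finType) (R : quiver T) (k : T)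
    (S : int * int * int) : Prop :=
  exists x z, uniq [:: x; k; z] /\ (skew R x k, skew R k z, skew R z x) = S.

Definition shaped (T : finType) (R : quiver T) (S : int * int * int) : Prop :=
  exists k, shaped_at R k S.

Lemma shaped_rot (T : finType) (R : quiver T) (X Y Z : int) :
  shaped R (X, Y, Z) -> shaped R (Y, Z, X).
Proof.
case=> y [x [z [u [<- <- <-]]]]; exists z, y, x; split=> //.
by rewrite -[[:: y; z; x]]/(rot 1 [:: x; y; z]) rot_uniq.
Qed.

Lemma shaped_at_rev (T : finType) (R : quiver T) (k : T) (X Y Z : int) :
  shaped_at R k (X, Y, Z) -> shaped_at R k (- Y, - X, - Z).
Proof.
case=> x [z [u [<- <- <-]]]; exists z, x; split.
  by rewrite -rev_uniq.
by rewrite -!skewC.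
Qed.

Lemma shaped_rev (T : finType) (R : quiver T) (X Y Z : int) :
  shaped R (X, Y, Z) -> shaped R (- Y, - X, - Z).
Proof. by case=> k /shaped_at_rev h; exists k. Qed.

(** A rotation brings any vertex to the middle, so mutation formulas are needed only there. *)
Lemma shaped_atP (T : finType) (R : quiver T) (k : T) (X Y Z : int) :
  #|T| = 3%N -> shaped R (X, Y, Z) ->
  [\/ shaped_at R k (X, Y, Z), shaped_at R k (Y, Z, X)
    | shaped_at R k (Z, X, Y)].
Proof.
move=> hT [y [x [z [u [<- <- <-]]]]].
have := mem_card3 k hT u; rewrite !inE => /or3P[] /eqP ->.
- apply: Or33; exists z, y; split=> //.
  by rewrite -[[:: z; x; y]]/(rot 2 [:: x; y; z]) rot_uniq.
- by apply: Or31; exists x, z.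
- apply: Or32; exists y, x; split=> //.
  by rewrite -[[:: y; z; x]]/(rot 1 [:: x; y; z]) rot_uniq.
Qed.

Lemma shaped_at_mutate (T : finType) (R : quiver T) (k : T) (X Y Z : int) :
  shaped_at R k (X, Y, Z) ->
  shaped_at (mutate R k) k
    (- X, - Y, Z + pos (- Y) * pos (- X) - pos X * pos Y).
Proof.
case=> x [z [u [<- <- <-]]]; exists x, z; split=> //.
move: u => /and3P[]; rewrite !inE negb_or => /andP[xk xz] kz _.
rewrite !skew_mutate !eqxx !orbT /= (negPf xk) [z == k]eq_sym (negPf kz) /=.
by rewrite (skewC R z k) (skewC R k x).
Qed.

(** Mutation reverses the path through [k]; reading the triangle backwards restores the signs and
    exchanges [X] and [Y]. *)
Lemma shaped_at_mutate_path (T : finType) (R : quiver T) (k : T) (X Y Z : int) :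
  shaped_at R k (X, Y, Z) -> 0 <= X -> 0 <= Y ->
  shaped_at (mutate R k) k (Y, X, X * Y - Z).
Proof.
move=> /shaped_at_mutate /shaped_at_rev + hX hY.
rewrite !opprK [pos (- _)]pos_0 ?mul0r; last by lia.
by rewrite !pos_id // addr0 opprB.
Qed.

(** The sign condition says that no path passes through [k], so only the arrows at [k] change. *)
Lemma shaped_at_mutate_sign (T : finType) (R : quiver T) (k : T) (X Y Z : int) :
  shaped_at R k (X, Y, Z) -> X * Y <= 0 ->
  shaped_at (mutate R k) k (- X, - Y, Z).
Proof.
move=> /shaped_at_mutate + hXY.
suff -> : Z + pos (- Y) * pos (- X) - pos X * pos Y = Z by [].
by rewrite /pos; nia.
Qed.

Lemma shaped_at_congr (T : finType) (R : quiver T) (k : T) (X Y Z X' Y' Z' : int) :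
  shaped_at R k (X, Y, Z) -> X = X' -> Y = Y' -> Z = Z' ->
  shaped_at R k (X', Y', Z').
Proof. by move=> + <- <- <-. Qed.

Lemma shaped_isomorphic (T : finType) (R R' : quiver T) (S : int * int * int) :
  #|T| = 3%N -> shaped R S -> shaped R' S -> isomorphic R R'.
Proof.
move=> hT [y [x [z [u <-]]]] [y' [x' [z' [u' [e1 e2 e3]]]]].
pose f (p q r p' q' r' t : T) := if t == p then p' else if t == q then q' else r'.
have fE p q r p' q' r' : uniq [:: p; q; r] ->
    [/\ f p q r p' q' r' p = p', f p q r p' q' r' q = q' & f p q r p' q' r' r = r'].
  move=> /and3P[]; rewrite !inE negb_or => /andP[pq pr] qr _; rewrite /f.
  by rewrite !eqxx [q == p]eq_sym [r == p]eq_sym [r == q]eq_sym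
             (negPf pq) (negPf pr) (negPf qr).
have [fx fy fz] := fE _ _ _ x' y' z' u.
have [gx gy gz] := fE _ _ _ x y z u'.
exists (f x y z x' y' z').
  exists (f x' y' z' x y z) => t.
    by have := mem_card3 t hT u; rewrite !inE => /or3P[] /eqP ->; congruence.
  by have := mem_card3 t hT u'; rewrite !inE => /or3P[] /eqP ->; congruence.
move=> i j; suff e : skew R' (f x y z x' y' z' i) (f x y z x' y' z' j) = skew R i j.
  by apply/eqP; rewrite -(eqr_nat int) !natz; rewrite !arr_skew e.
have ss (P : quiver T) (t : T) : skew P t t = 0 by rewrite /skew subrr.
have := mem_card3 i hT u; have := mem_card3 j hT u; rewrite !inE.
move=> /or3P[] /eqP -> /or3P[] /eqP ->; rewrite ?fx ?fy ?fz ?ss //;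
  by rewrite skewC [RHS]skewC; congr (- _).
Qed.

(** * Ascending mutations *)

Definition ascending (T : finType) (R : quiver T) (k : T) : Prop :=
  exists X Y Z, [/\ shaped_at R k (X, Y, Z), 2 <= X, 2 <= Y, X <= Z & Y <= Z].

Lemma ascending_heavy (T : finType) (R : quiver T) (k : T) :
  #|T| = 3%N -> ascending R k -> heavy R.
Proof.
move=> hT [X [Y [Z [[x [z [u [e1 e2 e3]]]] hX hY hXZ hYZ]]]].
have big i j : 2 <= skew R i j -> (2 <= arr R i j)%N.
  by have := arr_skew R i j; rewrite /pos; lia.
apply/forallP => i; apply/existsP.
have := mem_card3 i hT u; rewrite !inE => /or3P[] /eqP ->.
- by exists z; apply: big; lia.
- by exists x; apply: big; lia.
- by exists k; apply: big; lia.
Qed.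

(** At [j] meets the largest multiplicity [Z], together with some [X >= 2]. The opposite one,
    [Y <= Z], becomes [Z X - Y], which is at least [Z]. *)
Lemma ascending_mutate (T : finType) (R : quiver T) (k j : T) :
  #|T| = 3%N -> ascending R k -> j != k -> ascending (mutate R j) j.
Proof.
move=> hT [X [Y [Z [sk hX hY hXZ hYZ]]]] jk.
have [x [z [u e]]] := sk; move: e => [e1 e2 e3].
have := mem_card3 j hT u; rewrite !inE (negPf jk) /= => /orP[] /eqP ej.
  have : shaped_at R j (Z, X, Y).
    exists z, k; rewrite ej; split; last by congr (_, _, _).
    by rewrite -[[:: z; x; k]]/(rot 2 [:: x; k; z]) rot_uniq.
  move=> /shaped_at_mutate_path h; exists X, Z, (Z * X - Y).
  by split; [apply: h; lia | by [] | lia | nia | nia].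
have : shaped_at R j (Y, Z, X).
  exists k, x; rewrite ej; split; last by congr (_, _, _).
  by rewrite -[[:: k; z; x]]/(rot 1 [:: x; k; z]) rot_uniq.
move=> /shaped_at_mutate_path h; exists Z, Y, (Y * Z - X).
by split; [apply: h; lia | lia | by [] | nia | nia].
Qed.

(** Each step outside [L] remembers its last vertex [k]: mutation at [k] leads back, and mutation at
    any other vertex ascends again. *)
Inductive ascent (T : finType) (L : quiver T -> Prop) : quiver T -> Prop :=
| ascent_base R : L R -> ascent L R
| ascent_step R k : ascent L R -> ascending (mutate R k) k ->
    ascent L (mutate R k).

Lemma ascent_mutate (T : finType) (L : quiver T -> Prop) (R : quiver T) (j : T) :
  #|T| = 3%N ->
  (forall P k, L P -> L (mutate P k) \/ ascending (mutate P k) k) ->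
  ascent L R -> ascent L (mutate R j).
Proof.
move=> hT closed [P LP | P k aP asc].
  have [LP' | asc] := closed P j LP; first by left.
  by apply: ascent_step asc; left.
have [->|jk] := eqVneq j k; first by rewrite [mutate _ k]mutateK.
by apply: ascent_step; [exact: ascent_step | exact: ascending_mutate jk].
Qed.

Lemma ascent_light (T : finType) (L : quiver T -> Prop) (R : quiver T) :
  #|T| = 3%N -> ascent L R -> ~~ heavy R -> L R.
Proof.
move=> hT [P // | P k _ asc] /negP[]; exact: ascending_heavy asc.
Qed.

(** The whole mutation class lies in [ascent L], and everything added to [L] there is heavy. *)
Lemma in_mut_light (T : finType) (L : quiver T -> Prop) (A R : quiver T) :
  #|T| = 3%N ->
  (forall P k, L P -> L (mutate P k) \/ ascending (mutate P k) k) ->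
  L A -> in_mut A R -> ~~ heavy R -> L R.
Proof.
move=> hT closed LA [s ->]; apply: ascent_light => //.
elim/last_ind: s => [|s k IH]; first by left.
by rewrite foldl_rcons; apply: ascent_mutate.
Qed.

(** * Lists of six shapes closed under non-ascending mutations *)

Definition members (T : finType) (l : seq (int * int * int)) (R : quiver T) :=
  exists2 S, S \in l & shaped R S.

(** Excluded middle decides which shapes occur; one quiver is chosen for each that does, and the
    shape determines it up to isomorphism. *)
Lemma shaped_representatives (T : finType) (l : seq (int * int * int)) :
  #|T| = 3%N -> exists s : seq (quiver T),
    (size s <= size l)%N /\
    forall R : quiver T, members l R ->
      exists2 R' : quiver T, R' \in s & isomorphic R R'.
Proof.
move=> hT; elim: l => [|S l [s [hs IH]]]; first by exists [::]; split=> // R [].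
have [[P sP]|nP] := classic (exists P : quiver T, shaped P S).
  exists (P :: s); split=> // R [S' ]; rewrite inE => /orP[/eqP -> | lS'] sR.
    by exists P; [exact: mem_head | exact: shaped_isomorphic sP].
  have [|P' sP' iso] := IH R; first by exists S'.
  by exists P' => //; rewrite inE sP' orbT.
exists s; split=> [|R [S']]; first exact: leqW.
rewrite inE => /orP[/eqP -> sR | lS' sR]; first by case: nP; exists R.
by apply: IH; exists S'.
Qed.

(* Shapes of the quiver with a arrows x -> y, b arrows y -> z and c arrows
   x -> z, of its source and sink mutations, and of the mutations of these three
   at their middle vertices. *)
Definition acyclic_weights (a b c : int) : seq (int * int * int) :=
  [:: (a, b, - c); (b, c, - a); (c, a, - b);
      (c + a * b, b, a); (a + b * c, c, b); (b + c * a, a, c)].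

(* The analogue of acyclic_weights for c = 0. *)
Definition tree_weights (a b : int) : seq (int * int * int) :=
  [:: (a, b, 0); (b, a, 0); (- a, b, 0); (a, - b, 0); (a * b, b, a); (a * b, a, b)].

Lemma acyclic_weights_rot (T : finType) (a b c : int) (R : quiver T) :
  members (acyclic_weights b c a) R -> members (acyclic_weights a b c) R.
Proof.
case=> S hS sR; exists S => //; move: hS; rewrite !inE.
by case/or4P=> [->|->|->|/or3P[] ->]; rewrite ?orbT.
Qed.

Lemma tree_weights_swap (T : finType) (a b : int) (R : quiver T) :
  members (tree_weights b a) R -> members (tree_weights a b) R.
Proof.
case=> S hS sR; move: hS; rewrite !inE [b * a]mulrC.
case/or4P=> [|||/or3P[]] /eqP e; rewrite e in sR.
- by exists (b, a, 0) => //; rewrite !inE eqxx ?orbT.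
- by exists (a, b, 0) => //; rewrite !inE eqxx ?orbT.
- move/shaped_rev: sR; rewrite opprK oppr0 => sR.
  by exists (- a, b, 0) => //; rewrite !inE eqxx ?orbT.
- move/shaped_rev: sR; rewrite opprK oppr0 => sR.
  by exists (a, - b, 0) => //; rewrite !inE eqxx ?orbT.
- by exists (a * b, a, b) => //; rewrite !inE eqxx ?orbT.
- by exists (a * b, b, a) => //; rewrite !inE eqxx ?orbT.
Qed.

Tactic Notation "member" uconstr(S) :=
  exists (S : (int * int * int)%type); [by rewrite !inE eqxx ?orbT |].

(** The three cases are the middle vertex, which gives a cycle, the sink and the source. *)
Lemma acyclic_weights_path (T : finType) (a b c : int) (P : quiver T) (k : T) :
  #|T| = 3%N -> 1 <= a -> 1 <= b -> 1 <= c ->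
  shaped P (a, b, - c) ->
  members (acyclic_weights a b c) (mutate P k).
Proof.
move=> hT ha hb hc /(shaped_atP k hT)[] sP.
- member (c + a * b, b, a); apply/shaped_rot/shaped_rot.
  have := shaped_at_mutate_path sP ltac:(lia) ltac:(lia).
  by rewrite opprK [a * b + c]addrC; exists k.
- member (c, a, - b); apply/shaped_rot.
  have := shaped_at_mutate_sign sP ltac:(nia).
  by rewrite opprK; exists k.
- member (b, c, - a); apply/shaped_rot/shaped_rot.
  have := shaped_at_mutate_sign sP ltac:(nia).
  by rewrite opprK; exists k.
Qed.

(** Mutation opposite to [c + a b] leads back to the acyclic quiver. The other two ascend, unless
    [b = 1] or [a = 1] respectively, when they give another cycle of the list. *)
Lemma acyclic_weights_cycle (T : finType) (a b c : int) (P : quiver T) (k : T) :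
  #|T| = 3%N -> 1 <= a -> 1 <= b -> 1 <= c ->
  shaped P (c + a * b, b, a) ->
  members (acyclic_weights a b c) (mutate P k) \/ ascending (mutate P k) k.
Proof.
move=> hT ha hb hc /(shaped_atP k hT)[] sP;
  have sP' := shaped_at_mutate_path sP ltac:(nia) ltac:(nia).
- have [b2|b1] := leP 2 b.
    have [ha' hb'] : a <= c + a * b /\ b <= c + a * b by split; nia.
    (* Naming the sum [N] lowers the degree of the inequalities left to [nia]. *)
    right; exists b, (c + a * b), ((c + a * b) * b - a).
    by move: sP' ha' hb'; set N := c + a * b => *; split=> //; nia.
  left; have b11 : b = 1 by lia.
  member (a + b * c, c, b); apply/shaped_rot; exists k.
  by move: sP'; rewrite b11 => sP'; apply: (shaped_at_congr sP'); lia.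
- left; member (a, b, - c); exists k.
  by apply: (shaped_at_congr sP'); lia.
- have [a2|a1] := leP 2 a.
    have [ha' hb'] : a <= c + a * b /\ b <= c + a * b by split; nia.
    right; exists (c + a * b), a, (a * (c + a * b) - b).
    by move: sP' ha' hb'; set N := c + a * b => *; split=> //; nia.
  left; have a11 : a = 1 by lia.
  member (b + c * a, a, c); exists k.
  by move: sP'; rewrite a11 => sP'; apply: (shaped_at_congr sP'); lia.
Qed.

Lemma acyclic_weights_closed (T : finType) (a b c : int) (P : quiver T) (k : T) :
  #|T| = 3%N -> 1 <= a -> 1 <= b -> 1 <= c ->
  members (acyclic_weights a b c) P ->
  members (acyclic_weights a b c) (mutate P k) \/ ascending (mutate P k) k.
Proof.
move=> hT ha hb hc [S]; rewrite !inE.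
have rot1 R := @acyclic_weights_rot T a b c R.
have rot2 R := @acyclic_weights_rot T b c a R.
case/or4P=> [|||/or3P[]] /eqP -> sP.
- by left; apply: acyclic_weights_path.
- by left; apply/rot1/acyclic_weights_path.
- by left; apply/rot1/rot2/acyclic_weights_path.
- exact: acyclic_weights_cycle.
- by have [/rot1|] := acyclic_weights_cycle k hT hb hc ha sP; [left | right].
- by have [/rot2/rot1|] := acyclic_weights_cycle k hT hc ha hb sP; [left | right].
Qed.

Lemma tree_weights_path (T : finType) (a b : int) (P : quiver T) (k : T) :
  #|T| = 3%N -> 0 <= a -> 0 <= b ->
  shaped P (a, b, 0) -> members (tree_weights a b) (mutate P k).
Proof.
move=> hT ha hb /(shaped_atP k hT)[] sP.
- member (a * b, b, a); apply/shaped_rot/shaped_rot; exists k.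
  by move: (shaped_at_mutate_path sP ha hb); rewrite subr0.
- member (a, - b, 0); apply/shaped_rot/shaped_rot; exists k.
  by apply: (shaped_at_congr (shaped_at_mutate_sign sP ltac:(lia))); lia.
- member (- a, b, 0); apply/shaped_rot; exists k.
  by apply: (shaped_at_congr (shaped_at_mutate_sign sP ltac:(lia))); lia.
Qed.

Lemma tree_weights_out (T : finType) (a b : int) (P : quiver T) (k : T) :
  #|T| = 3%N -> 0 <= a -> 0 <= b ->
  shaped P (- a, b, 0) -> members (tree_weights a b) (mutate P k).
Proof.
move=> hT ha hb /(shaped_atP k hT)[] sP;
  have sP' := shaped_at_mutate_sign sP ltac:(nia).
- member (a, - b, 0); exists k.
  by apply: (shaped_at_congr sP'); lia.
- member (b, a, 0); apply/shaped_rot.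
  by exists k; apply: (shaped_at_congr (shaped_at_rev sP')); lia.
- member (a, b, 0); apply/shaped_rot.
  by exists k; apply: (shaped_at_congr sP'); lia.
Qed.

Lemma tree_weights_in (T : finType) (a b : int) (P : quiver T) (k : T) :
  #|T| = 3%N -> 0 <= a -> 0 <= b ->
  shaped P (a, - b, 0) -> members (tree_weights a b) (mutate P k).
Proof.
move=> hT ha hb /(shaped_atP k hT)[] sP;
  have sP' := shaped_at_mutate_sign sP ltac:(nia).
- member (- a, b, 0); exists k.
  by apply: (shaped_at_congr sP'); lia.
- member (a, b, 0); apply/shaped_rot/shaped_rot.
  by exists k; apply: (shaped_at_congr sP'); lia.
- member (b, a, 0); apply/shaped_rot/shaped_rot.
  by exists k; apply: (shaped_at_congr (shaped_at_rev sP')); lia.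
Qed.

(** If [a] or [b] is 0 the cycle degenerates to at most one edge. Otherwise mutation opposite to
    [a b] restores the path, and the others ascend unless the relevant factor is 1, when they also
    give a path. *)
Lemma tree_weights_cycle (T : finType) (a b : int) (P : quiver T) (k : T) :
  #|T| = 3%N -> 0 <= a -> 0 <= b ->
  shaped P (a * b, b, a) ->
  members (tree_weights a b) (mutate P k) \/ ascending (mutate P k) k.
Proof.
move=> hT ha hb /(shaped_atP k hT)[] sP;
  have sP' := shaped_at_mutate_path sP ltac:(nia) ltac:(nia).
- have [a0|a0] := leP a 0.
    have a00 : a = 0 by lia.
    left; member (b, a, 0); exists k.
    by move: sP'; rewrite a00 => sP'; apply: (shaped_at_congr sP'); lia.
  have [b0|b0] := leP b 0.
    have b00 : b = 0 by lia.
    left; member (a, b, 0); apply/shaped_rot/shaped_rot; exists k.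
    move: sP'; rewrite b00 => /shaped_at_rev sP'.
    by apply: (shaped_at_congr sP'); lia.
  have [b1|b2] := leP b 1.
    have b11 : b = 1 by lia.
    left; member (b, a, 0); exists k.
    by move: sP'; rewrite b11 => sP'; apply: (shaped_at_congr sP'); lia.
  have [ha' hb'] : a <= a * b /\ b <= a * b by split; nia.
  right; exists b, (a * b), (a * b * b - a).
  by move: sP' ha' hb'; set N := a * b => *; split=> //; nia.
- left; member (a, b, 0); exists k.
  by apply: (shaped_at_congr sP'); lia.
- have [b0|b0] := leP b 0.
    have b00 : b = 0 by lia.
    left; member (a, b, 0); apply/shaped_rot; exists k.
    by move: sP'; rewrite b00 => sP'; apply: (shaped_at_congr sP'); lia.
  have [a0|a0] := leP a 0.
    have a00 : a = 0 by lia.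
    left; member (b, a, 0); apply/shaped_rot/shaped_rot; exists k.
    move: sP'; rewrite a00 => /shaped_at_rev sP'.
    by apply: (shaped_at_congr sP'); lia.
  have [a1|a2] := leP a 1.
    have a11 : a = 1 by lia.
    left; member (b, a, 0); exists k.
    by move: sP'; rewrite a11 => sP'; apply: (shaped_at_congr sP'); lia.
  have [ha' hb'] : a <= a * b /\ b <= a * b by split; nia.
  right; exists (a * b), a, (a * (a * b) - b).
  by move: sP' ha' hb'; set N := a * b => *; split=> //; nia.
Qed.

Lemma tree_weights_closed (T : finType) (a b : int) (P : quiver T) (k : T) :
  #|T| = 3%N -> 0 <= a -> 0 <= b ->
  members (tree_weights a b) P ->
  members (tree_weights a b) (mutate P k) \/ ascending (mutate P k) k.
Proof.
move=> hT ha hb [S]; rewrite !inE.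
case/or4P=> [|||/or3P[]] /eqP -> sP.
- by left; apply: tree_weights_path.
- by left; apply/tree_weights_swap/tree_weights_path.
- by left; apply: tree_weights_out.
- by left; apply: tree_weights_in.
- exact: tree_weights_cycle.
- rewrite mulrC in sP.
  by have [/tree_weights_swap|] := tree_weights_cycle k hT hb ha sP; [left | right].
Qed.

(** * Reaching an acyclic quiver from a quiver that is not heavy *)

Definition acyclic_shaped (T : finType) (A : quiver T) : Prop :=
  exists a b c, [/\ 0 <= a, 0 <= b, 0 <= c & shaped A (a, b, - c)].

Lemma acyclic_shaped_acyclic (T : finType) (A : quiver T) :
  #|T| = 3%N -> acyclic_shaped A -> acyclic A.
Proof.
move=> hT [a [b [c [ha hb hc [y [x [z [u [e1 e2 e3]]]]]]]]].
(* A topological order: every arrow increases [rank], so a cycle would yield [rank t < rank t]. *)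
pose rank t := if t == x then 0%N else if t == y then 1%N else 2.
have mono i j : (0 < arr A i j)%N -> (rank i < rank j)%N.
  have : (arr A i j)%:Z = pos (skew A i j) := arr_skew A i j.
  move: (u) => /and3P[]; rewrite !inE negb_or => /andP[xy xz] yz _.
  have sx : skew A x x = 0 by rewrite /skew subrr.
  have sy : skew A y y = 0 by rewrite /skew subrr.
  have sz : skew A z z = 0 by rewrite /skew subrr.
  have f1 := skewC A y x; have f2 := skewC A z y; have f3 := skewC A x z.
  have := mem_card3 i hT u; have := mem_card3 j hT u; rewrite !inE /rank.
  move=> /or3P[] /eqP -> /or3P[] /eqP ->;
    rewrite ?eqxx ?(eq_sym y x) ?(eq_sym z x) ?(eq_sym z y);
    rewrite ?(negPf xy) ?(negPf xz) ?(negPf yz) /pos; lia.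
case=> // t c' /= cyc; exfalso.
have trans : transitive (fun i j => (rank i < rank j)%N).
  by move=> i j k; apply: ltn_trans.
have /(order_path_min trans)/allP/(_ t) :
    path (fun i j => (rank i < rank j)%N) t (rcons c' t).
  exact: sub_path cyc.
by rewrite mem_rcons mem_head ltnn => /(_ isT).
Qed.

(** Rotation and reversal bring all other sign patterns to nonnegative, nonnegative, nonpositive. *)
Lemma shaped_acyclic_shaped (T : finType) (R : quiver T) (X Y Z : int) :
  shaped R (X, Y, Z) ->
  ~ (0 < X /\ 0 < Y /\ 0 < Z) -> ~ (X < 0 /\ Y < 0 /\ Z < 0) ->
  acyclic_shaped R.
Proof.
have key X' Y' Z' : shaped R (X', Y', Z') -> 0 <= X' -> 0 <= Y' -> Z' <= 0 ->
    acyclic_shaped R.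
  by move=> sR *; exists X', Y', (- Z'); split; [| | lia | rewrite opprK].
move=> s1 npos nneg; have s2 := shaped_rot s1; have s3 := shaped_rot s2.
have r1 := shaped_rev s1; have r2 := shaped_rev s2; have r3 := shaped_rev s3.
have : [\/ [/\ 0 <= X, 0 <= Y & Z <= 0], [/\ 0 <= Y, 0 <= Z & X <= 0]
         | [/\ 0 <= Z, 0 <= X & Y <= 0]] \/
       [\/ [/\ X <= 0, Y <= 0 & 0 <= Z], [/\ Y <= 0, Z <= 0 & 0 <= X]
         | [/\ Z <= 0, X <= 0 & 0 <= Y]].
  have [X0|X0|X0] := ltgtP X 0; have [Y0|Y0|Y0] := ltgtP Y 0;
    have [Z0|Z0|Z0] := ltgtP Z 0;
  solve [ by case: npos | by case: nneg
        | by left; apply: Or31; split; lia | by left; apply: Or32; split; lia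
        | by left; apply: Or33; split; lia | by right; apply: Or31; split; lia
        | by right; apply: Or32; split; lia | by right; apply: Or33; split; lia ].
case=> -[] [h1 h2 h3].
- exact: key s1 h1 h2 h3.
- exact: key s2 h1 h2 h3.
- exact: key s3 h1 h2 h3.
- by apply: key r1 _ _ _; lia.
- by apply: key r2 _ _ _; lia.
- by apply: key r3 _ _ _; lia.
Qed.

(** If [Z <= Y], a first mutation replaces [Z] by [Y - Z], and a second replaces [Y] by
    [(Y - Z) - Y = - Z], which breaks the cycle. The case [Y < Z] is symmetric. *)
Lemma cyclic_one_acyclic_shaped (T : finType) (R : quiver T) (Y Z : int) :
  #|T| = 3%N -> shaped R (1, Y, Z) -> 0 < Y -> 0 < Z ->
  exists2 A, in_mut R A & acyclic_shaped A.
Proof.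
move=> hT sR Y0 Z0; have [YZ|ZY] := leP Z Y.
  have [k sk] := sR.
  have s1 := shaped_at_mutate_path sk ltac:(lia) ltac:(lia); rewrite mul1r in s1.
  have [j sj] : shaped (mutate R k) (1, Y - Z, Y) by apply: shaped_rot; exists k.
  have s2 := shaped_at_mutate_path sj ltac:(lia) ltac:(lia).
  exists (mutate (mutate R k) j).
    by apply/in_mut_step/in_mut_step/in_mut_refl.
  by apply: (@shaped_acyclic_shaped _ _ (Y - Z) 1 (1 * (Y - Z) - Y));
    [exists j | lia | lia].
have [k sk] := shaped_rot (shaped_rot sR).
have s1 := shaped_at_mutate_path sk ltac:(lia) ltac:(lia); rewrite mulr1 in s1.
have [j sj] : shaped (mutate R k) (Z - Y, 1, Z).
  by apply/shaped_rot/shaped_rot; exists k.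
have s2 := shaped_at_mutate_path sj ltac:(lia) ltac:(lia).
exists (mutate (mutate R k) j).
  by apply/in_mut_step/in_mut_step/in_mut_refl.
by apply: (@shaped_acyclic_shaped _ _ 1 (Z - Y) ((Z - Y) * 1 - Z));
  [exists j | lia | lia].
Qed.

(** Some vertex receives at most one arrow from each other vertex; in a cycle the arrow into it
    therefore has multiplicity exactly 1. *)
Lemma light_acyclic_shaped (T : finType) (R : quiver T) :
  #|T| = 3%N -> ~~ heavy R -> exists2 A, in_mut R A & acyclic_shaped A.
Proof.
move=> hT; rewrite negb_forall => /existsP[k]; rewrite negb_exists => /forallP light.
have le1 l : skew R l k <= 1.
  by have := light l; have := arr_skew R l k; rewrite /pos; lia.
have [i ik] : exists i, i != k.
  by have /card_gt0P[i] : (0 < #|predC1 k|)%N; [rewrite cardC1 hT | exists i].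
have [j u] := triple_exists hT ik.
have sR : shaped R (skew R i k, skew R k j, skew R j i) by exists k, i, j.
have [[X0 [Y0 Z0]]|np] :=
    classic (0 < skew R i k /\ 0 < skew R k j /\ 0 < skew R j i).
  have X1 : skew R i k = 1 by have := le1 i; lia.
  by rewrite X1 in sR; apply: cyclic_one_acyclic_shaped sR _ _.
have [[X0 [Y0 Z0]]|nn] :=
    classic (skew R i k < 0 /\ skew R k j < 0 /\ skew R j i < 0).
  have Y1 : - skew R k j = 1 by have := le1 j; rewrite (skewC R j); lia.
  have sR' := shaped_rev sR; rewrite Y1 in sR'.
  by apply: cyclic_one_acyclic_shaped sR' _ _; lia.
by exists R; [exact: in_mut_refl | exact: shaped_acyclic_shaped sR np nn].
Qed.

Lemma acyclic_light_members (T : finType) (A : quiver T) :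
  #|T| = 3%N -> acyclic_shaped A -> exists l : seq (int * int * int),
    size l = 6%N /\ forall R, in_mut A R -> ~~ heavy R -> members l R.
Proof.
move=> hT [a [b [c [ha hb hc sA]]]].
have tree x y : 0 <= x -> 0 <= y -> members (tree_weights x y) A ->
    exists l : seq (int * int * int),
      size l = 6%N /\ forall R, in_mut A R -> ~~ heavy R -> members l R.
  move=> hx hy mA; exists (tree_weights x y); split=> // R AR.
  by apply: in_mut_light AR => // P k; apply: tree_weights_closed.
(* A zero multiplicity is rotated into the last place, which gives a path, an in-tree or an out-tree
   at the middle vertex. *)
have [c0|c1] := leP c 0.
  apply: (tree a b) => //; member (a, b, 0).
  by move: sA; have -> : c = 0 by lia.
have [a0|a1] := leP a 0.
  apply: (tree b c) => //; member (b, - c, 0); apply: shaped_rot.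
  by move: sA; have -> : a = 0 by lia.
have [b0|b1] := leP b 0.
  apply: (tree c a) => //; member (- c, a, 0); apply/shaped_rot/shaped_rot.
  by move: sA; have -> : b = 0 by lia.
exists (acyclic_weights a b c); split=> // R AR.
apply: in_mut_light AR => // [P k|].
  by apply: acyclic_weights_closed => //; lia.
by member (a, b, - c).
Qed.

Close Scope ring_scope.

Theorem theorem7p2 (T : finType) (hT : #|T| = 3) (Q : quiver T) :
  (~ mutation_acyclic Q -> forall R : quiver T, in_mut Q R -> ~ has_mgs R) /\
  (exists s : seq (quiver T),
      size s <= 6 /\
      (forall R : quiver T, in_mut Q R -> has_mgs R ->
         exists2 R' : quiver T, R' \in s & isomorphic R R')).
Proof.
have light (R : quiver T) : has_mgs R -> ~~ heavy R.
  by move=> mR; apply/negP => hR; apply: heavy_no_mgs mR.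
split.
  move=> nQ R QR /light /(light_acyclic_shaped hT)[A RA sA]; apply: nQ.
  by exists A; [exact: in_mut_trans RA | exact: acyclic_shaped_acyclic].
(* If the whole class is heavy, the empty list works. Otherwise the class contains an acyclic
   quiver, whose six shapes cover all quivers of the class that are not heavy. *)
have [[P [QP lP]]|nlight] := classic (exists P, in_mut Q P /\ ~~ heavy P); last first.
  by exists [::]; split=> // R QR /light lR; case: nlight; exists R.
have [A PA sA] := light_acyclic_shaped hT lP.
have [l [l6 hl]] := acyclic_light_members hT sA.
have [s [sl hs]] := shaped_representatives l hT.
exists s; split=> [|R QR /light lR]; first by rewrite -l6.
apply: hs; apply: hl lR; apply: in_mut_trans QR.
by apply: in_mut_sym; apply: in_mut_trans PA.
Qed.
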